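(* Let $M$ be a $\mathbb{Z}^k$-graded $R$-module and let $i_1,\dots,i_p$ ($p\ge 1$) be distinct elements of $\{1,\dots,k\}$. Then $$\mathbb{C}_{B_{i_1}+\cdots+B_{i_p}}(M)^*\subseteq \mathbb{C}_{B_{i_1}}(M)^*\cap\cdots\cap\mathbb{C}_{B_{i_p}}(M)^*.$$
   Context: $S$ is an arbitrary commutative unitary ring, $k\ge 1$, $n_1,\dots,n_k\ge 1$, and $R=S[X_{i,j} : 1\le i\le k,\ 1\le j\le n_i]$ with its standard $\mathbb{Z}^k$-grading: elements of $S$ have degree $0$ and $\deg X_{i,j}=e_i$, the $i$-th canonical generator of $\mathbb{Z}^k$. $B_i=(X_{i,1},\dots,X_{i,n_i})$. Modules are not assumed finitely generated. For a finitely generated homogeneous ideal $I$, $H^i_I(M)$ is the $i$-th cohomology of the Čech complex of $M$ with respect to a finite homogeneous generating set of $I$. $\mathbb{C}_I(M)=\{\gamma\in\mathbb{Z}^k : H^i_I(M)_\gamma\ne 0\text{ for some } i\}$. For $E\subseteq\mathbb{Z}^k$, $E^*=E-\mathbb{N}^k=\{e-\mu : e\in E,\ \mu\in\mathbb{N}^k\}$, with $\mathbb{N}=\mathbb{Z}_{\ge0}$. *)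

(* Defs.v *)
From HB Require Import structures.
From mathcomp Require Import all_boot all_order all_algebra.
From mathcomp Require Import generic_quotient boolp classical_sets.
From mathcomp Require Import mpoly zify ring.

Set Implicit Arguments.
Unset Strict Implicit.
Unset Printing Implicit Defensive.

Import GRing.Theory.
Local Open Scope ring_scope.
Local Open Scope classical_set_scope.
Local Open Scope quotient_scope.

Section Localization.
Context (R : comNzRingType) (M : lmodType R) (f : R).

(* The pair (m, a) stands for the fraction m / f^a. *)
Definition loc_rel (x y : M * nat) : bool :=
  `[< exists c, f ^+ (c + y.2) *: x.1 = f ^+ (c + x.2) *: y.1 >].

Lemma loc_rel_refl : reflexive loc_rel.
Proof. by move=> x; apply/asboolP; exists 0%N. Qed.

Lemma loc_rel_sym : ssrbool.symmetric loc_rel.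
Proof. by move=> x y; apply/asboolP/asboolP => -[c e]; exists c. Qed.

Lemma loc_rel_trans : transitive loc_rel.
Proof.
move=> [m b] [l a] [n c] /asboolP[/= u e1] /asboolP[/= v e2].
apply/asboolP; exists (u + v + b)%N => /=.
have -> : (u + v + b + c = (v + c) + (u + b))%N by lia.
have -> : (u + v + b + a = (u + a) + (v + b))%N by lia.
by rewrite exprD -scalerA e1 scalerA mulrC -scalerA e2 scalerA -exprD.
Qed.

Canonical loc_equiv :=
  EquivRel loc_rel loc_rel_refl loc_rel_sym loc_rel_trans.

Definition loc := {eq_quot loc_equiv}.
HB.instance Definition _ := Choice.on loc.
HB.instance Definition _ := EqQuotient.on loc.

Definition frac (m : M) (a : nat) : loc := \pi_loc (m, a).

Lemma fracP (x : loc) : exists m a, x = frac m a.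
Proof. by exists (repr x).1, (repr x).2; rewrite /frac -surjective_pairing reprK. Qed.

Lemma eq_fracP m a n b :
  frac m a = frac n b <->
  exists c, f ^+ (c + b) *: m = f ^+ (c + a) *: n.
Proof.
by split=> [/eqmodP/asboolP // | h]; apply/eqmodP/asboolP.
Qed.

Lemma frac_expand c m a : frac m a = frac (f ^+ c *: m) (c + a).
Proof. by apply/eq_fracP; exists 0%N; rewrite scalerA -exprD !add0n addnC. Qed.

Definition loc_add (x y : loc) : loc :=
  let: (m, a) := repr x in let: (n, b) := repr y in
  frac (f ^+ b *: m + f ^+ a *: n) (a + b).

Definition loc_opp (x : loc) : loc :=
  let: (m, a) := repr x in frac (- m) a.

Lemma repr_frac m a :
  exists c, f ^+ (c + a) *: (repr (frac m a)).1
            = f ^+ (c + (repr (frac m a)).2) *: m.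
Proof.
by apply/eq_fracP; rewrite /frac -surjective_pairing reprK.
Qed.

Lemma loc_addE m a n b :
  loc_add (frac m a) (frac n b) = frac (f ^+ b *: m + f ^+ a *: n) (a + b).
Proof.
rewrite /loc_add; have [u] := repr_frac m a; have [v] := repr_frac n b.
case: (repr (frac m a)) => m' a'; case: (repr (frac n b)) => n' b' /= e2 e1.
apply/eq_fracP; exists (u + v)%N; rewrite !scalerDr !scalerA -!exprD.
congr (_ + _).
- have -> : (u + v + (a + b) + b' = (v + b + b') + (u + a))%N by lia.
  by rewrite exprD -scalerA e1 scalerA -exprD; congr (_ ^+ _ *: _); lia.
- have -> : (u + v + (a + b) + a' = (u + a + a') + (v + b))%N by lia.
  by rewrite exprD -scalerA e2 scalerA -exprD; congr (_ ^+ _ *: _); lia.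
Qed.

Lemma loc_oppE m a : loc_opp (frac m a) = frac (- m) a.
Proof.
rewrite /loc_opp; have [u] := repr_frac m a.
case: (repr (frac m a)) => m' a' /= e.
by apply/eq_fracP; exists u; rewrite !scalerN e.
Qed.

Lemma loc_addA : associative loc_add.
Proof.
move=> x y z; have [m [a ->]] := fracP x; have [n [b ->]] := fracP y.
have [p [c ->]] := fracP z; rewrite !loc_addE addnA; congr frac.
rewrite !scalerDr !scalerA -!exprD addrA.
by congr (_ ^+ _ *: _ + _ ^+ _ *: _ + _ ^+ _ *: _); lia.
Qed.

Lemma loc_addC : commutative loc_add.
Proof.
move=> x y; have [m [a ->]] := fracP x; have [n [b ->]] := fracP y.
by rewrite !loc_addE addrC addnC.
Qed.

Lemma loc_add0 : left_id (frac 0 0) loc_add.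
Proof.
move=> x; have [m [a ->]] := fracP x.
by rewrite loc_addE scaler0 add0r expr0 scale1r add0n.
Qed.

Lemma loc_addN : left_inverse (frac 0 0) loc_opp loc_add.
Proof.
move=> x; have [m [a ->]] := fracP x.
rewrite loc_oppE loc_addE scalerN addNr; apply/eq_fracP; exists 0%N.
by rewrite !scaler0.
Qed.

HB.instance Definition _ :=
  GRing.isZmodule.Build loc loc_addA loc_addC loc_add0 loc_addN.

End Localization.

(* The canonical map M_f -> M_g, m / f^a |-> (h^a m) / g^a, for g = f h; the
   equation is not an argument, so that no cast is needed when g is only
   provably equal to f h. *)
Definition loc_map (R : comNzRingType) (M : lmodType R) (f g h : R)
    (x : loc M f) : loc M g :=
  let: (m, a) := repr x in frac g (h ^+ a *: m) a.

Lemma loc_mapE (R : comNzRingType) (M : lmodType R) (f g h : R) :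
  g = f * h -> forall (m : M) a,
  loc_map g h (frac f m a) = frac g (h ^+ a *: m) a.
Proof.
move=> -> m a; rewrite /loc_map; have [u] := repr_frac f m a.
case: (repr (frac f m a)) => m' a' /= e; apply/eq_fracP; exists u.
rewrite !scalerA !exprMn.
have -> : f ^+ (u + a) * h ^+ (u + a) * h ^+ a'
          = h ^+ (u + a + a') * f ^+ (u + a) by rewrite !exprD; ring.
have -> : f ^+ (u + a') * h ^+ (u + a') * h ^+ a
          = h ^+ (u + a + a') * f ^+ (u + a') by rewrite !exprD; ring.
by rewrite -!scalerA e.
Qed.

(* The Cech complex of M with respect to a finite family F: its term in
   cohomological degree q is the product of the localizations of M at
   \prod_(t in T) F t over the q-element sets T (for q = 0 it is M itself). *)
Section Cech.
Context (R : comNzRingType) (M : lmodType R) (r : nat) (F : 'I_r -> R).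

Definition cech_den (T : {set 'I_r}) : R := \prod_(t in T) F t.

(* One type serves for the cochains of all degrees: as a cochain of degree q,
   c is only looked at on the sets of cardinality q. *)
Definition cochain := forall T : {set 'I_r}, loc M (cech_den T).

Definition cech_d (c : cochain) : cochain := fun T =>
  \sum_(t in T)
    loc_map (cech_den T) (F t) (c (T :\ t))
      *~ (-1) ^+ #|[set u in T | (u < t)%N]%SET|.

Definition cocycle (q : nat) (c : cochain) : Prop :=
  forall T : {set 'I_r}, #|T| = q.+1 -> cech_d c T = 0.

Definition coboundary (q : nat) (c : cochain) : Prop :=
  exists b : cochain, forall T : {set 'I_r}, #|T| = q -> c T = cech_d b T.

End Cech.

Section Ideals.
Context (R : comNzRingType).

Definition ideal_span (I : finType) (g : I -> R) : set R :=
  [set x | exists c : I -> R, x = \sum_j c j * g j].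

Definition ideal_sum (p : nat) (J : 'I_p -> set R) : set R :=
  [set x | exists y : 'I_p -> R, (forall j, J j (y j)) /\ x = \sum_j y j].

End Ideals.

(* S[X_{i,j} : i < k, j < n i], with (i, j) numbered through enum_rank. *)
Notation multi_index n := {i : 'I__ & 'I_(n i)}.
Notation multi_poly S n := {mpoly S[#|{: multi_index n}|]}.

Section Multigraded.
Context (S : comNzRingType) (k : nat) (n : 'I_k -> nat).
Local Notation R := (multi_poly S n).
Local Notation Zk := {ffun 'I_k -> int}.

Definition var_rank (i : 'I_k) (j : 'I_(n i)) : 'I_#|{: multi_index n}| :=
  enum_rank (Tagged (fun i => 'I_(n i)) j).

Definition var (i : 'I_k) (j : 'I_(n i)) : R := 'X_(var_rank j).

Definition block_ideal (i : 'I_k) : set R := ideal_span (@var i).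

Definition multideg (m : 'X_{1..#|{: multi_index n}|}) : Zk :=
  [ffun i => (\sum_(j < n i) m (var_rank j))%N%:Z].

(* The zero polynomial is homogeneous of every degree. *)
Definition homogeneous (d : Zk) (f : R) : Prop :=
  forall m, m \in msupp f -> multideg m = d.

(* M is the internal direct sum of the additive subgroups Mg g, and
   R_d Mg_g is contained in Mg_(g + d). *)
Record is_grading (M : lmodType R) (Mg : Zk -> set M) : Prop := {
  grading0 : forall g, Mg g 0;
  gradingB : forall g x y, Mg g x -> Mg g y -> Mg g (x - y);
  gradingZ : forall d g f x, homogeneous d f -> Mg g x -> Mg (g + d) (f *: x);
  grading_span : forall x, exists (D : seq Zk) (c : Zk -> M),
    (forall g, Mg g (c g)) /\ x = \sum_(g <- D) c g;
  grading_free : forall (D : seq Zk) (c : Zk -> M), uniq D ->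
    (forall g, Mg g (c g)) -> \sum_(g <- D) c g = 0 ->
    forall g, g \in D -> c g = 0
}.

Record hgens (I : set R) := HGens {
  hgens_size : nat;
  hgens_elt :> 'I_hgens_size -> R;
  hgens_homogeneous : forall t, exists d, homogeneous d (hgens_elt t);
  hgens_span : ideal_span hgens_elt = I
}.

Section Cohomology.
Context (M : lmodType R) (Mg : Zk -> set M).

(* The degree g part of M_f, for f homogeneous: deg (m / f^a) = deg m - a deg f. *)
Definition loc_homogeneous (f : R) (g : Zk) (x : loc M f) : Prop :=
  exists d m a, [/\ homogeneous d f, Mg (g + d *+ a) m & x = frac f m a].

Definition cochain_homogeneous r (F : 'I_r -> R) (q : nat) (g : Zk)
    (c : cochain M F) : Prop :=
  forall T : {set 'I_r}, #|T| = q -> loc_homogeneous g (c T).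

(* H^q(M)_g is the set of classes of the cocycles of degree g, so it is nonzero
   when one of these cocycles is not a coboundary. *)
Definition cech_cohomology_neq0 r (F : 'I_r -> R) (q : nat) (g : Zk) : Prop :=
  exists c : cochain M F,
    [/\ cochain_homogeneous q g c, cocycle q c & ~ coboundary q c].

Definition cohomology_support (I : set R) (F : hgens I) : set Zk :=
  [set g | exists q, cech_cohomology_neq0 F q g].

End Cohomology.
End Multigraded.

Arguments block_ideal S [k] n i.

Definition star (k : nat) (E : set {ffun 'I_k -> int}) :
    set {ffun 'I_k -> int} :=
  [set g | exists e (mu : {ffun 'I_k -> nat}),
    E e /\ g = e - [ffun i => (mu i)%:Z]].

(* Main.v *)
From HB Require Import structures.
Require Import Defs.
From mathcomp Require Import all_boot all_order all_algebra.
From mathcomp Require Import boolp classical_sets mpoly zify ring.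

Set Implicit Arguments.
Unset Strict Implicit.
Unset Printing Implicit Defensive.

Import GRing.Theory.
Local Open Scope ring_scope.
Local Open Scope classical_set_scope.

(** The Cech complex of [M] on a family [f] is the colimit over [a] of the Koszul
complexes of [f_1^a, ..., f_r^a] on [M], so vanishing of its cohomology in a given
degree can be tested on Koszul cochains with values in [M].  Koszul complexes grow by
mapping cones, which gives two facts.  If [H_G(M)] vanishes in all degrees of
[e + N^k] then adjoining a homogeneous [f] to [G] preserves this: the extra term of
the long exact sequence is the localization of [H_G(M)] at [f], and its elements of
degree [e] have numerators in degrees [e + a deg f].  If [g] lies in the ideal of [F]
then adjoining [g] to [F] changes nothing, because a power of [g] kills every Koszul
cocycle.  So if [e] is not in the starred support of [B_(i_j)], adjoin the generators
of the sum of the blocks to those of [B_(i_j)], then drop the latter. *)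

(** * Graded modules without projections *)

Section Grading.
Context (R : comNzRingType) (M : lmodType R) (Gam : zmodType).
Context (Mg : Gam -> set M).

Record graded : Prop := {
  graded0 : forall g, Mg g 0;
  gradedB : forall g x y, Mg g x -> Mg g y -> Mg g (x - y);
  graded_span : forall x, exists (D : seq Gam) (c : Gam -> M),
    (forall g, Mg g (c g)) /\ x = \sum_(g <- D) c g;
  graded_free : forall (D : seq Gam) (c : Gam -> M), uniq D ->
    (forall g, Mg g (c g)) -> \sum_(g <- D) c g = 0 ->
    forall g, g \in D -> c g = 0
}.

(** Degrees of ring elements are seen only through their action on [M], so [R] carries no grading
    here and [Mg] may be replaced by another family of subsets, such as [off_degree Mg]. *)
Definition has_degree (f : R) (d : Gam) : Prop :=
  forall g x, Mg g x -> Mg (g + d) (f *: x).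

(* The complement of [Mg g] in [M]; it replaces the projection onto the component
   of degree [g]. *)
Inductive off_degree (g : Gam) : M -> Prop :=
| Off0 : off_degree g 0
| OffD h x y : h != g -> Mg h x -> off_degree g y -> off_degree g (x + y).

Context (grM : graded).

Lemma gradedN g x : Mg g x -> Mg g (- x).
Proof. by move=> h; rewrite -[- x]add0r; apply: gradedB => //; apply: graded0. Qed.

Lemma gradedD g x y : Mg g x -> Mg g y -> Mg g (x + y).
Proof. by move=> hx hy; rewrite -[y]opprK; apply: gradedB => //; apply: gradedN. Qed.

Lemma off_degreeN g x : off_degree g x -> off_degree g (- x).
Proof.
elim=> [|h {}x y hg hx _ ih]; first by rewrite oppr0; apply: Off0.
by rewrite opprD; apply: OffD hg _ ih; apply: gradedN.
Qed.

Lemma off_degreeB g x y : off_degree g x -> off_degree g y -> off_degree g (x - y).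
Proof.
move=> hx /off_degreeN hy; elim: hx => [|h {}x z hg hx _ ih]; first by rewrite add0r.
by rewrite -addrA; apply: OffD hg hx ih.
Qed.

Lemma off_degreeZ f d g x :
  has_degree f d -> off_degree g x -> off_degree (g + d) (f *: x).
Proof.
move=> fd; elim=> [|h {}x y hg hx _ ih]; first by rewrite scaler0; apply: Off0.
rewrite scalerDr; apply: OffD ih; last exact: fd hx.
by rewrite (inj_eq (addIr _)).
Qed.

(** [graded_free] speaks of distinct degrees, so terms of equal degree are merged. *)
Lemma off_degree_sum g x : off_degree g x ->
  exists (D : seq Gam) (c : Gam -> M), [/\ uniq D, g \notin D,
    forall h, Mg h (c h) & x = \sum_(h <- D) c h].
Proof.
elim=> [|h {}x y hg hx _ [D [c [uD gD hc ->]]]].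
  by exists [::], (fun=> 0); split=> // [h|]; rewrite ?big_nil //; apply: graded0.
have [hD|hD] := boolP (h \in D).
- exists D, (fun u => if u == h then x + c h else c u); split=> // [u|].
    by case: eqP => // ->; apply: gradedD.
  rewrite !(big_rem _ hD) /= eqxx addrA; congr (_ + _).
  rewrite !big_seq; apply: eq_bigr => u; rewrite mem_rem_uniq // !inE.
  by case/andP => /negPf->.
exists (h :: D), (fun u => if u == h then x else c u); split=> /=.
- by rewrite hD.
- by rewrite inE eq_sym negb_or hg.
- by move=> u; case: eqP => // ->.
rewrite big_cons eqxx; congr (_ + _).
rewrite !big_seq; apply: eq_bigr => u uD'; case: eqP => // uh.
by rewrite -uh uD' in hD.
Qed.

Lemma graded_off_degree g x : Mg g x -> off_degree g x -> x = 0.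
Proof.
move=> hx /off_degree_sum[D [c [uD gD hc e]]].
(* Putting [- x] in degree [g] turns the decomposition of [x] off [g] into a relation with sum
   zero. *)
have := @graded_free grM (g :: D) (fun u => if u == g then - x else c u).
move=> /(_ _ _ _ g); rewrite /= gD uD big_cons inE eqxx.
have -> : \sum_(u <- D) (if u == g then - x else c u) = x.
  rewrite e !big_seq; apply: eq_bigr => u uD'; case: eqP => // ug.
  by rewrite -ug uD' in gD.
rewrite addNr => h; apply/eqP; rewrite -oppr_eq0; apply/eqP; apply: h => // u.
by case: eqP => // ->; apply: gradedN.
Qed.

Lemma graded_split g x : exists y z, [/\ Mg g y, off_degree g z & x = y + z].
Proof.
have [D [c [hc ->]]] := @graded_span grM x.
elim: D => [|h D [y [z [hy hz e]]]].
  exists 0, 0; rewrite big_nil addr0; split=> //; first exact: graded0.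
  exact: Off0.
rewrite big_cons e; have [<-|hg] := eqVneq g h.
  by exists (c g + y), z; rewrite addrA; split=> //; apply: gradedD.
exists y, (c h + z); rewrite addrCA; split=> //.
by apply: OffD hz; rewrite // eq_sym.
Qed.

End Grading.

(** * Koszul complexes as iterated mapping cones, and their colimit *)

Section Koszul.
Context (R : comNzRingType) (M : lmodType R) (Gam : zmodType).
Implicit Types (l : seq (R * Gam)) (a N : nat).

(** The total module, all cohomological degrees together. It does not depend on the exponent [a],
    which enters only through the differential and the degrees. *)
Fixpoint koszul l : lmodType R :=
  if l is _ :: l' then (koszul l' * koszul l')%type : lmodType R else M.

(* The mapping cone of the multiplication by [x.1 ^+ a]: [z.1] collects the components
   on the sets without [x], [z.2] those on the sets containing it. *)
Fixpoint kd a l : koszul l -> koszul l :=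
  if l is x :: l' return koszul l -> koszul l
  then fun z => (kd a z.1, x.1 ^+ a *: z.1 - kd a z.2)
  else fun=> 0.

(* The transition map of the colimit, from exponent [a] to exponent [N + a]. *)
Fixpoint kt N l : koszul l -> koszul l :=
  if l is x :: l' return koszul l -> koszul l
  then fun z => (kt N z.1, x.1 ^+ N *: kt N z.2)
  else id.

Implicit Type P : Gam -> set M.

(* [z.2] stands for a numerator over [x.1 ^+ a]; hence the shift. *)
Fixpoint khom P a l (e : Gam) : koszul l -> Prop :=
  if l is x :: l' return koszul l -> Prop
  then fun z => khom P a e z.1 /\ khom P a (e + x.2 *+ a) z.2
  else P e.

Lemma kd_linear a l : linear (@kd a l).
Proof.
elim: l => [|x l ih] c /=; first by move=> *; rewrite scaler0 addr0.
move=> [u1 u2] [v1 v2]; congr pair => /=; first exact: ih.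
rewrite ih !scalerDr scalerN !scalerA mulrC !opprD.
by rewrite addrACA.
Qed.

HB.instance Definition _ a l := GRing.isLinear.Build R _ _ _ _ (@kd_linear a l).

Lemma kt_linear N l : linear (@kt N l).
Proof.
elim: l => [|x l ih] c //= [u1 u2] [v1 v2]; congr pair => /=; first exact: ih.
by rewrite ih scalerDr !scalerA mulrC.
Qed.

HB.instance Definition _ N l := GRing.isLinear.Build R _ _ _ _ (@kt_linear N l).

Lemma kt_kd N a l (z : koszul l) : kt N (kd a z) = kd (N + a) (kt N z).
Proof.
elim: l z => [z|x l ih [u v]] /=; first by []; rewrite ih; congr pair.
by rewrite linearB /= !linearZ /= ih scalerBr scalerA exprD scalerN.
Qed.

Lemma kt_kt N N' l (z : koszul l) : kt N (kt N' z) = kt (N + N') z.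
Proof.
elim: l z => [z|x l ih [u v]] /=; first by []; rewrite ih; congr pair.
by rewrite linearZ /= ih scalerA exprD.
Qed.

Lemma khom0 P a l e : (forall g, P g 0) -> khom P a e (0 : koszul l).
Proof. by move=> P0; elim: l e => [|x l ih] e //=; split; apply: ih. Qed.

Lemma khomB P a l e (z w : koszul l) :
  (forall g x y, P g x -> P g y -> P g (x - y)) ->
  khom P a e z -> khom P a e w -> khom P a e (z - w).
Proof.
move=> PB; elim: l e z w => [|x l ih] e //=; first exact: PB.
by move=> [z1 z2] [w1 w2] /= [? ?] [? ?]; split; apply: ih.
Qed.

Lemma khomZ P a l e f d (z : koszul l) :
  has_degree P f d -> khom P a e z -> khom P a (e + d) (f *: z).
Proof.
move=> fd; elim: l e z => [|x l ih] e /=; first exact: fd.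
by move=> [z1 z2] /= [h1 h2]; split; rewrite 1?addrAC; apply: ih.
Qed.

Lemma has_degreeX P f d N : has_degree P f d -> has_degree P (f ^+ N) (d *+ N).
Proof.
move=> fd; elim: N => [|N ih] g x hx; first by rewrite addr0 scale1r.
by rewrite exprSr mulrS -scalerA addrA; apply/ih/fd.
Qed.

Definition degrees_ok P l := forall x, x \in l -> has_degree P x.1 x.2.

Lemma degrees_ok_cons P x l :
  degrees_ok P (x :: l) -> has_degree P x.1 x.2 /\ degrees_ok P l.
Proof.
move=> h; split; first by apply: h; rewrite mem_head.
by move=> y yl; apply: h; rewrite inE yl orbT.
Qed.

Lemma khom_kd P a l e (z : koszul l) :
  (forall g, P g 0) -> (forall g x y, P g x -> P g y -> P g (x - y)) ->
  degrees_ok P l -> khom P a e z -> khom P a e (kd a z).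
Proof.
move=> P0 PB; elim: l e z => [|x l ih] e //= [z1 z2] /degrees_ok_cons[xd lok] /= [h1 h2].
split; first exact: ih.
apply: khomB => //; last exact: ih.
by apply: khomZ h1; apply: has_degreeX.
Qed.

Lemma khom_kt P N a l e (z : koszul l) :
  degrees_ok P l -> khom P a e z -> khom P (N + a) e (kt N z).
Proof.
elim: l e z => [|x l ih] e //= [z1 z2] /degrees_ok_cons[xd lok] /= [h1 h2].
split; first exact: ih.
rewrite mulrnDr addrA addrAC.
by apply: khomZ; [apply: has_degreeX | apply: ih].
Qed.

Context (Mg : Gam -> set M) (grM : graded Mg).

Lemma khom_split a l e (z : koszul l) : exists y w,
  [/\ khom Mg a e y, khom (off_degree Mg) a e w & z = y + w].
Proof.
elim: l e z => [|x l ih] e /=; first exact: graded_split.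
move=> [z1 z2]; have [y1 [w1 [? ? ->]]] := ih e z1.
have [y2 [w2 [? ? ->]]] := ih (e + x.2 *+ a) z2.
by exists (y1, y2), (w1, w2).
Qed.

Lemma khom_off_degree a l e (z : koszul l) :
  khom Mg a e z -> khom (off_degree Mg) a e z -> z = 0.
Proof.
elim: l e z => [|x l ih] e /=; first exact: graded_off_degree.
by move=> [z1 z2] /= [? ?] [? ?]; congr pair; apply: ih; eauto.
Qed.

Lemma degrees_ok_off l : degrees_ok Mg l -> degrees_ok (off_degree Mg) l.
Proof. by move=> h x /h xd g y; apply: off_degreeZ. Qed.

(** The part of [b] off degree [e] has a boundary that is both of degree [e] and off degree [e],
    hence zero; it can be discarded. *)
Lemma khom_boundary a l e (b : koszul l) : degrees_ok Mg l ->
  khom Mg a e (kd a b) -> exists2 b', khom Mg a e b' & kd a b' = kd a b.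
Proof.
move=> lok hb; have [y [w [hy hw def_b]]] := khom_split a e b.
exists y => //; apply/eqP; rewrite -subr_eq0 -opprB oppr_eq0 -linearB /=.
rewrite def_b addrAC subrr add0r; apply/eqP; apply: (@khom_off_degree a l e).
  have -> : kd a w = kd a b - kd a y by rewrite def_b linearD /= addrAC subrr add0r.
  apply: khomB => //; first exact: gradedB.
  by apply: khom_kd => //; [apply: graded0 | apply: gradedB].
apply: khom_kd hw; [exact: Off0 | exact: off_degreeB | exact: degrees_ok_off].
Qed.

(* That is, colim_a H(K(l^a; M)) is zero in internal degree [e]. *)
Definition vanish l e := forall a (z : koszul l), khom Mg a e z -> kd a z = 0 ->
  exists N b, kt N z = kd (N + a) b.

(** The long exact sequence of the cone, by hand. The component without [f] is bounded first, in
    degree [e]. What then remains of the other component is a cocycle in degree [e + d *+ (N + a)],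
    where [N] is not known beforehand: hence the vanishing for every [i]. *)
Lemma vanish_cons f d l e : has_degree Mg f d -> degrees_ok Mg l ->
  (forall i, vanish l (e + d *+ i)) -> vanish ((f, d) :: l) e.
Proof.
move=> fd lok van a [x y] /= [hx hy] [dx dy].
have [] := van 0%N a x; rewrite ?addr0 // => N [b0 e0].
have [] := @khom_boundary (N + a) l e b0 lok; first by rewrite -e0; apply: khom_kt.
move=> b hb eb; rewrite -eb in e0 => {b0 eb}.
(* This is the second component of [kt N (x, y) - kd (N + a) (b, 0)], whose first component is
   zero. *)
pose y' := f ^+ N *: kt N y - f ^+ (N + a) *: b.
have [||N' [b' e']] := van (N + a)%N (N + a)%N y'.
- apply: khomB; first exact: gradedB.
    rewrite mulrnDr addrA addrAC; apply: khomZ; first exact: has_degreeX.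
    exact: khom_kt.
  by apply: khomZ => //; apply: has_degreeX.
- rewrite /y' linearB /= !linearZ /= -kt_kd -e0.
  move/eqP: dy; rewrite subr_eq0 => /eqP <-.
  by rewrite linearZ /= scalerA exprD scalerN subrr.
(* The minus sign cancels the one that the cone puts on the differential of its second component. *)
exists (N' + N)%N, (kt N' b, - (f ^+ N' *: b')) => /=; rewrite -!kt_kt -addnA.
congr pair; first by rewrite e0 kt_kd.
rewrite linearN opprK /= linearZ /= -e' /y' linearB /= !linearZ /=.
rewrite scalerDr !scalerN !scalerA -!exprD.
by rewrite addrC subrK.
Qed.

(** * Ring elements with a power annihilating Koszul cohomology *)

Section RadicalAction.
Context (l : seq (R * Gam)) (a : nat).

(** The annihilator of the cohomology at exponent [a]; [rad_kills] is its radical. *)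
Definition kills (h : R) :=
  forall z : koszul l, kd a z = 0 -> exists w, h *: z = kd a w.

Definition rad_kills (h : R) := exists L, kills (h ^+ L).

Lemma killsD h h' : kills h -> kills h' -> kills (h + h').
Proof.
move=> k k' z dz; have [w e] := k z dz; have [w' e'] := k' z dz.
by exists (w + w'); rewrite scalerDl e e' linearD.
Qed.

Lemma killsM c h : kills h -> kills (c * h).
Proof.
move=> k z dz; have [w e] := k z dz.
by exists (c *: w); rewrite -scalerA e linearZ.
Qed.

Lemma kills0 : kills 0.
Proof. by move=> z _; exists 0; rewrite scale0r linear0. Qed.

(** The radical of an ideal is an ideal: in the binomial expansion with exponent [L + L'], each term
    contains the [L]-th power of one summand or the [L']-th power of the other. *)
Lemma rad_kills_sum (I : finType) (c h : I -> R) :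
  (forall i, rad_kills (h i)) -> rad_kills (\sum_i c i * h i).
Proof.
move=> rh; elim/big_rec: _ => [|i x _ [L' kx]].
  by exists 1%N; rewrite expr1; apply: kills0.
have [L ki] := rh i; exists (L + L')%N; rewrite exprDn.
elim/big_rec: _ => [|j y _ ky]; first exact: kills0.
apply: killsD => //; rewrite -mulr_natl; apply: killsM.
have [jL|Lj] := leqP j L'.
  have -> : (L + L' - j = (L' - j) + L)%N by lia.
  by rewrite exprD (exprMn L) mulrC !mulrA; apply: killsM.
by rewrite -(subnK (ltnW Lj)) exprD mulrA; apply: killsM.
Qed.

End RadicalAction.

(** The exponent doubles: one factor [f ^+ L] bounds [z1] by [w1], after which
    [f ^+ L *: z2 - x.1 ^+ a *: w1] is a cocycle, and a second factor bounds it. *)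
Lemma rad_kills_cons a x l f : rad_kills l a f -> rad_kills (x :: l) a f.
Proof.
case=> L k; exists (L + L)%N => -[z1 z2] /= [dz1 dz2]; have [w1 e1] := k z1 dz1.
have [|w2 e2] := k (f ^+ L *: z2 - x.1 ^+ a *: w1).
  rewrite linearB /= !linearZ /= scalerN -e1 scalerA mulrC -scalerA.
  by rewrite -scalerBr -opprB dz2 oppr0 scaler0.
exists (f ^+ L *: w1, - w2) => /=; rewrite exprD -scalerA; congr pair.
  by rewrite [RHS]linearZ /= -e1.
rewrite /= linearN opprK /= -e2 scalerBr !scalerA -exprD.
by rewrite [x.1 ^+ a * _]mulrC addrC subrK.
Qed.

(** On a cone over [f], multiplication by [f ^+ a] is null-homotopic through
    [(z1, z2) |-> (z2, 0)]. *)
Lemma mem_rad_kills a l f d : (f, d) \in l -> rad_kills l a f.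
Proof.
elim: l => [//|[g d'] l ih]; rewrite inE => /predU1P[[-> _]|/ih]; last first.
  exact: rad_kills_cons.
exists a => -[z1 z2] /= [dz1 dz2]; exists (z2, 0) => /=.
move/eqP: dz2; rewrite subr_eq0 => /eqP e; congr pair => //.
by rewrite linear0 subr0.
Qed.

(** Since a power of [g] makes [z] a boundary, a transition of [z] lifts to a cocycle of the cone;
    the first component of a primitive of the lift is a primitive over [l]. *)
Lemma vanish_behead g d l e : has_degree Mg g d -> degrees_ok Mg l ->
  (forall a, rad_kills l a g) -> vanish ((g, d) :: l) e -> vanish l e.
Proof.
move=> gd lok rk van a z hz dz; have [N k] := rk a; have [w ew] := k z dz.
(* The factor [g ^+ a] raises [g ^+ N] to the power that the cone uses at exponent [N + a]. *)
have dy : kd (N + a) (g ^+ a *: kt N w) = g ^+ (N + a) *: kt N z.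
  by rewrite linearZ /= -kt_kd -ew linearZ /= scalerA -exprD addnC.
have hz' := khom_kt N lok hz.
(* [w] need not be homogeneous; [y] is a homogeneous replacement with the same boundary. *)
have [|y hy ey] := @khom_boundary (N + a) l (e + d *+ (N + a)) (g ^+ a *: kt N w) lok.
  by rewrite dy; apply: khomZ hz'; apply: has_degreeX.
have [||N' [[b1 b2] /= [eb _]]] := van (N + a)%N (kt N z, y) => //=.
  by rewrite -kt_kd dz linear0 ey dy subrr.
by exists (N' + N)%N, b1; rewrite -kt_kt -addnA eb.
Qed.

(** * Reordering the generators of a Koszul complex *)

Definition kmor l l' (phi : koszul l -> koszul l') :=
  [/\ forall c u v, phi (c *: u - v) = c *: phi u - phi v,
    forall a z, phi (kd a z) = kd a (phi z),
    forall N z, phi (kt N z) = kt N (phi z) &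
    forall a e z, khom Mg a e z -> khom Mg a e (phi z)].

(** This presents [koszul l'] as a retract of [koszul l], at all exponents at once and compatibly
    with transitions and degrees; [vanish] then passes from [l] to [l']. *)
Definition kiso l l' := exists (phi : koszul l -> koszul l') psi,
  [/\ kmor phi, kmor psi & cancel psi phi].

Lemma kmor_comp l l' l'' (phi : koszul l -> koszul l') (psi : koszul l' -> koszul l'') :
  kmor phi -> kmor psi -> kmor (psi \o phi).
Proof.
move=> [lp dp tp hp] [lp' dp' tp' hp']; split=> /=.
- by move=> c u v /=; rewrite lp lp'.
- by move=> a z; rewrite dp dp'.
- by move=> N z; rewrite tp tp'.
- by move=> a e z /hp/hp'.
Qed.

Lemma kmor0 l l' (phi : koszul l -> koszul l') : kmor phi -> phi 0 = 0.
Proof. by case=> lp _ _ _; have := lp 1 0 0; rewrite !scale1r subr0 subrr. Qed.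

Lemma kiso_trans l1 l2 l3 : kiso l1 l2 -> kiso l2 l3 -> kiso l1 l3.
Proof.
move=> [f [g [mf mg fg]]] [f' [g' [mf' mg' fg']]].
exists (f' \o f), (g \o g'); split; try exact: kmor_comp.
exact: can_comp.
Qed.

Lemma kiso_refl l : kiso l l.
Proof. by exists id, id. Qed.

Lemma kmor_cons x l l' (phi : koszul l -> koszul l') : kmor phi ->
  @kmor (x :: l) (x :: l') (fun z => (phi z.1, phi z.2)).
Proof.
move=> mp; have [lp dp tp hp] := mp; split=> /=.
- by move=> c u v; rewrite !lp.
- by move=> a [u v] /=; rewrite dp lp dp.
- move=> N [u v] /=; rewrite !tp; congr pair.
  by rewrite -[_ *: _ in LHS]subr0 lp (kmor0 mp) subr0 tp.
- by move=> a e [u v] /= [? ?]; split; apply: hp.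
Qed.

Lemma kiso_cons x l l' : kiso l l' -> kiso (x :: l) (x :: l').
Proof.
move=> [f [g [mf mg fg]]].
exists (fun z => (f z.1, f z.2)), (fun z => (g z.1, g z.2)).
by split; [apply: kmor_cons | apply: kmor_cons | move=> [u v] /=; rewrite !fg].
Qed.

(** The sign on the component containing both generators is that of exchanging two factors of an
    exterior product. *)
Definition kswap x y l (z : koszul (x :: y :: l)) : koszul (y :: x :: l) :=
  ((z.1.1, z.2.1), (z.1.2, - z.2.2)).

Lemma kmor_swap x y l : kmor (@kswap x y l).
Proof.
split=> /=.
- move=> c [[u1 u2] [u3 u4]] [[v1 v2] [v3 v4]]; rewrite /kswap /=; congr (_, (_, _)).
  by rewrite /= scalerN opprD.
- move=> a [[u1 u2] [u3 u4]]; rewrite /kswap /=; congr (_, (_, _)).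
  by rewrite /= (linearN (@kd a l)) opprK !opprD !opprK addrCA.
- move=> N [[u1 u2] [u3 u4]]; rewrite /kswap /=; congr (_, (_, _)).
  by rewrite linearN /= !scalerN !scalerA mulrC.
- move=> a e [[u1 u2] [u3 u4]] /= [[? ?] [? h]]; split=> //; split=> //.
  rewrite -[- u4]add0r addrAC; apply: khomB => //; first exact: gradedB.
  by apply: khom0; apply: graded0.
Qed.

Lemma kiso_swap x y l : kiso (x :: y :: l) (y :: x :: l).
Proof.
exists (@kswap x y l), (@kswap y x l); split; try exact: kmor_swap.
by move=> [[u1 u2] [u3 u4]]; rewrite /kswap /= opprK.
Qed.

Lemma kiso_catC l1 l2 : kiso (l1 ++ l2) (l2 ++ l1).
Proof.
elim: l1 => [|x l1 ih] /=; first by rewrite cats0; apply: kiso_refl.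
apply: kiso_trans (kiso_cons x ih) _; elim: l2 {ih} => [|y l2 ih] /=.
  exact: kiso_refl.
exact: kiso_trans (kiso_swap x y _) (kiso_cons y ih).
Qed.

Lemma vanish_iso l l' e : kiso l l' -> vanish l e -> vanish l' e.
Proof.
move=> [f [g [mf mg fg]]] van a z hz dz; have [lg dg tg hg] := mg.
have [lf df tf hf] := mf; have [||N [b eb]] := van a (g z); first exact: hg.
  by rewrite -dg dz (kmor0 mg).
by exists N, (f b); rewrite -df -eb tf fg.
Qed.

(** [P] is a submonoid containing the degrees of [l1], later a copy of [N^k]. Each adjunction
    consumes all multiples of one degree, so vanishing is carried on all of [e + P]. *)
Lemma vanish_catl l1 l2 e (P : set Gam) : degrees_ok Mg (l1 ++ l2) ->
  (forall x, x \in l1 -> P x.2) -> P 0 -> (forall d d', P d -> P d' -> P (d + d')) ->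
  (forall d, P d -> vanish l2 (e + d)) -> forall d, P d -> vanish (l1 ++ l2) (e + d).
Proof.
move=> lok Pl P0 PD van; elim: l1 lok Pl => [//|[f d'] l1 ih] /= /degrees_ok_cons[fd lok] Pl d Pd.
apply: vanish_cons => // i; rewrite -addrA; apply: ih => //.
  by move=> x xl; apply: Pl; rewrite inE xl orbT.
apply: (PD) => //; elim: i => [//|i Pi]; rewrite mulrS; apply: (PD) => //.
by apply: (Pl (f, d')); rewrite mem_head.
Qed.

Lemma vanish_drop l1 l2 e : degrees_ok Mg (l1 ++ l2) ->
  (forall x a, x \in l1 -> rad_kills l2 a x.1) -> vanish (l1 ++ l2) e -> vanish l2 e.
Proof.
elim: l1 => [//|[g d] l1 ih] /= /degrees_ok_cons[gd lok] rk van.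
apply: ih => // [x a xl|]; first by apply: rk; rewrite inE xl orbT.
apply: vanish_behead van => // a.
(* The action is known over [l2] only; it extends to the generators of [l1] still present. *)
have: rad_kills l2 a g by apply: (rk (g, d)); rewrite mem_head.
by elim: (l1) => [//|x l ih] /ih; apply: rad_kills_cons.
Qed.

End Koszul.

(** * Subsets of ['I_r.+1], split according to membership of [ord0] *)

Section OrdinalSets.
Context (r : nat).
Implicit Types (T : {set 'I_r.+1}) (U : {set 'I_r}).

Definition shrink T : {set 'I_r} := lift ord0 @^-1: T.

Lemma in_shrink T u : (u \in shrink T) = (lift ord0 u \in T).
Proof. by rewrite inE. Qed.

Lemma shrink_lift U : shrink (lift ord0 @: U) = U.
Proof. by apply/setP => u; rewrite in_shrink mem_imset //; apply: lift_inj. Qed.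

Lemma ord0_lift U : (ord0 \in lift ord0 @: U) = false.
Proof. by apply/negP => /imsetP[u _]. Qed.

Lemma shrink_setU1 U : shrink (ord0 |: lift ord0 @: U) = U.
Proof. by apply/setP => u; rewrite in_shrink !inE /= mem_imset //; apply: lift_inj. Qed.

Lemma lift_shrink T : ord0 \notin T -> lift ord0 @: shrink T = T.
Proof.
move=> h; apply/setP => u; case: (unliftP ord0 u) => [v ->|->].
  by rewrite mem_imset ?in_shrink //; apply: lift_inj.
by rewrite ord0_lift (negPf h).
Qed.

Lemma setU1_shrink T : ord0 \in T -> ord0 |: lift ord0 @: shrink T = T.
Proof.
move=> h; apply/setP => u; rewrite !inE; case: (unliftP ord0 u) => [v ->|->].
  by rewrite mem_imset ?in_shrink //; apply: lift_inj.
by rewrite eqxx h.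
Qed.

Lemma shrinkD0 T : shrink (T :\ ord0) = shrink T.
Proof. by apply/setP => u; rewrite !inE. Qed.

Lemma shrinkD1 T u : shrink (T :\ lift ord0 u) = shrink T :\ u.
Proof. by apply/setP => v; rewrite !inE (inj_eq lift_inj). Qed.

Lemma big_shrink (V : Type) (idx : V) (op : Monoid.law idx) T (E : 'I_r.+1 -> V) :
  \big[op/idx]_(t in T) E t =
  op (if ord0 \in T then E ord0 else idx) (\big[op/idx]_(t in shrink T) E (lift ord0 t)).
Proof.
rewrite big_mkcond big_ord_recl [in RHS]big_mkcond; congr (op _ _).
by apply: eq_bigr => t _; rewrite in_shrink.
Qed.

Lemma card_shrink T : #|T| = ((ord0 \in T) + #|shrink T|)%N.
Proof. by rewrite -!sum1_card big_shrink; case: (_ \in _). Qed.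

End OrdinalSets.

(** The recursion on [r] lets [koszul M (famseq F)] unfold by computation in the dependent
    recursions below. *)
Fixpoint famseq (A : Type) r : ('I_r -> A) -> seq A :=
  if r is r'.+1 return ('I_r -> A) -> seq A
  then fun F => F ord0 :: famseq (fun t => F (lift ord0 t)) else fun=> [::].

Lemma mem_famseq (A : eqType) r (F : 'I_r -> A) x :
  reflect (exists t, x = F t) (x \in famseq F).
Proof.
elim: r F x => [|r ih] F x /=; first by right=> -[[]].
rewrite inE; apply: (iffP orP) => [[/eqP->|/ih[t ->]]|[t ->]]; [by eexists | by eexists |].
case: (unliftP ord0 t) => [u ->|->]; [right|by left].
by apply/ih; exists u.
Qed.

(** * Koszul cochains as families indexed by subsets *)

Section Coefficients.
Context (R : comNzRingType) (M : lmodType R) (Gam : zmodType).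

(** A cochain is a nested pair with [2^r] leaves; [T] records where the second component is taken.
    [koszul_of] rebuilds the cochain from its leaves. *)
Fixpoint kcoef r : forall F : 'I_r -> R * Gam, koszul M (famseq F) -> {set 'I_r} -> M :=
  if r is r'.+1
    return forall F : 'I_r -> R * Gam, koszul M (famseq F) -> {set 'I_r} -> M
  then fun F z T => kcoef (if ord0 \in T then z.2 else z.1) (shrink T)
  else fun F z T => z.

Fixpoint koszul_of r : forall F : 'I_r -> R * Gam, ({set 'I_r} -> M) -> koszul M (famseq F) :=
  if r is r'.+1
    return forall F : 'I_r -> R * Gam, ({set 'I_r} -> M) -> koszul M (famseq F)
  then fun F m =>
    (@koszul_of r' (fun t => F (lift ord0 t)) (fun U => m (lift ord0 @: U)),
     @koszul_of r' (fun t => F (lift ord0 t)) (fun U => m (ord0 |: lift ord0 @: U)))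
  else fun F m => m finset.set0.

Lemma kcoef_of r (F : 'I_r -> R * Gam) m T : kcoef (koszul_of F m) T = m T.
Proof.
elim: r F m T => [|r ih] F m T /=; first by congr m; apply/setP => -[].
case: ifPn => h; rewrite ih; first by rewrite setU1_shrink.
by rewrite lift_shrink.
Qed.

Lemma kcoef_eq0 r (F : 'I_r -> R * Gam) (z : koszul M (famseq F)) :
  (forall T, kcoef z T = 0) -> z = 0.
Proof.
elim: r F z => [|r ih] F /=; first by move=> z /(_ finset.set0).
move=> [z1 z2] h; congr pair; apply: ih => T.
  by have := h (lift ord0 @: T); rewrite ord0_lift shrink_lift.
by have := h (ord0 |: lift ord0 @: T); rewrite setU11 shrink_setU1.
Qed.

Lemma kcoef_linear r (F : 'I_r -> R * Gam) T : linear (fun z => @kcoef r F z T).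
Proof.
elim: r F T => [|r ih] F T //= c [u1 u2] [v1 v2].
by case: ifP => _; rewrite ih.
Qed.

Lemma kcoefB r (F : 'I_r -> R * Gam) (z w : koszul M (famseq F)) T :
  kcoef (z - w) T = kcoef z T - kcoef w T.
Proof. by rewrite -scaleN1r addrC kcoef_linear scaleN1r addrC. Qed.

Lemma kcoefZ r (F : 'I_r -> R * Gam) c (z : koszul M (famseq F)) (T : {set 'I_r}) :
  kcoef (c *: z) T = c *: kcoef z T.
Proof.
have k0 : kcoef (0 : koszul M (famseq F)) T = 0 by rewrite -(subr0 0) kcoefB subrr.
by rewrite -[c *: z]addr0 kcoef_linear k0 addr0.
Qed.

Lemma kcoef_kt r (F : 'I_r -> R * Gam) N (z : koszul M (famseq F)) (T : {set 'I_r}) :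
  kcoef (kt N z) T = cech_den (fun t => (F t).1) T ^+ N *: kcoef z T.
Proof.
elim: r F z T => [|r ih] F z T /=.
  by rewrite /cech_den big_pred0 ?expr1n ?scale1r // => -[].
rewrite /cech_den big_shrink /=; case: ifP => _; last by rewrite mul1r ih.
by rewrite kcoefZ ih exprMn scalerA.
Qed.

Lemma khom_kcoef r (F : 'I_r -> R * Gam) P a e (z : koszul M (famseq F)) :
  khom P a e z <-> forall T : {set 'I_r}, P (e + (\sum_(t in T) (F t).2) *+ a) (kcoef z T).
Proof.
elim: r F e z => [|r ih] F e z /=.
  have e0 (T : {set 'I_0}) : \sum_(t in T) (F t).2 = 0 by rewrite big_pred0 // => -[].
  by split=> [h T|/(_ finset.set0)]; rewrite e0 mul0rn addr0.
case: z => z1 z2; split=> /= [[/ih h1 /ih h2] T|h].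
  rewrite big_shrink /=; case: ifP => _; last by rewrite add0r; apply: h1.
  by rewrite mulrnDl addrA; apply: h2.
split; apply/ih => T.
  by have := h (lift ord0 @: T); rewrite big_shrink ord0_lift shrink_lift /= add0r.
have := h (ord0 |: lift ord0 @: T).
by rewrite big_shrink setU11 shrink_setU1 /= mulrnDl addrA.
Qed.

(** The cone differential has the Cech signs: when [ord0] is in [T], it precedes every other
    element, which accounts for the minus sign on the second component. *)
Lemma kcoef_kd r (F : 'I_r -> R * Gam) a (z : koszul M (famseq F)) (T : {set 'I_r}) :
  kcoef (kd a z) T =
  \sum_(t in T) ((F t).1 ^+ a *: kcoef z (T :\ t)) *~ (-1) ^+ #|[set u in T | (u < t)%N]%SET|.
Proof.
elim: r F z T => [|r ih] F z T /=; first by rewrite big_pred0 // => -[].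
have card_lt t : #|[set u in T | (u < lift ord0 t)%N]%SET| =
    ((ord0 \in T) + #|[set u in shrink T | (u < t)%N]%SET|)%N.
  rewrite card_shrink inE andbT; congr (_ + #|pred_of_set _|)%N.
  by apply/setP => u; rewrite !inE.
rewrite big_shrink /= (eq_bigr (fun t => (F (lift ord0 t)).1 ^+ a *:
  kcoef (if ord0 \in T then z.2 else z.1) (shrink T :\ t) *~
  (-1) ^+ ((ord0 \in T) + #|[set u in shrink T | (u < t)%N]%SET|))); last first.
  by move=> t _; rewrite card_lt shrinkD1 !inE.
case: ifP => h; last by rewrite add0r ih.
rewrite kcoefB kcoefZ ih !inE eqxx /= shrinkD0; congr (_ + _).
  by rewrite (_ : [set u in T | (u < 0)%N]%SET = finset.set0) ?cards0 //;
    apply/setP => u; rewrite !inE andbF.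
by rewrite -sumrN; apply: eq_bigr => t _; rewrite exprS mulN1r mulrNz.
Qed.

End Coefficients.

(** * The Cech complex as the colimit of Koszul complexes *)

Section CechKoszul.
Context (R : comNzRingType) (M : lmodType R).

Lemma frac_eq0 (f : R) (m : M) a : Defs.frac f m a = 0 <-> exists c, f ^+ c *: m = 0.
Proof.
split=> [/eq_fracP[c]|[c e]]; first by rewrite scaler0 addn0; exists c.
by apply/eq_fracP; exists c; rewrite scaler0 addn0.
Qed.

(** With the exponent fixed first, forming a fraction is an additive map. *)
Definition frac_at (f : R) a (m : M) : loc M f := Defs.frac f m a.

Lemma frac_at_zmod_morphism f a : zmod_morphism (frac_at f a).
Proof.
move=> x y; rewrite -[- frac_at f a y]/(loc_opp _) loc_oppE.
rewrite -[RHS]/(loc_add _ _) loc_addE -scalerDr.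
exact: frac_expand.
Qed.

HB.instance Definition _ f a :=
  GRing.isZmodMorphism.Build M (loc M f) (frac_at f a) (frac_at_zmod_morphism f a).

Lemma loc_map0 (f g h : R) : g = f * h -> loc_map g h (0 : loc M f) = 0.
Proof. by move=> e; rewrite (loc_mapE e) scaler0. Qed.

Lemma cech_denD1 r (f : 'I_r -> R) (T : {set 'I_r}) t : t \in T ->
  cech_den f T = cech_den f (T :\ t) * f t.
Proof. by move=> tT; rewrite mulrC /cech_den (big_setD1 t). Qed.

(** There are finitely many [T], so the largest exponent serves for all; [P] stands for a degree
    condition that survives expanding a fraction. *)
Lemma common_exponent r (f : 'I_r -> R) (P : {set 'I_r} -> nat -> M -> Prop) (c : cochain M f) :
  (forall T a N m, P T a m -> P T (N + a)%N (cech_den f T ^+ N *: m)) ->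
  (forall T, exists a m, P T a m /\ c T = frac_at _ a m) ->
  exists a m, forall T, P T a (m T) /\ c T = frac_at _ a (m T).
Proof.
move=> Pup /choice[a /choice[m cP]]; pose b := \max_T a T.
exists b, (fun T => cech_den f T ^+ (b - a T) *: m T) => T.
have le : (a T <= b)%N by apply: leq_bigmax.
have [PT eT] := cP T; split; first by rewrite -{1}(subnK le); apply: Pup.
by rewrite eT /frac_at (frac_expand _ (b - a T)) subnK.
Qed.

Context (Gam : zmodType) (r : nat) (F : 'I_r -> R * Gam).
Let f t := (F t).1.
Let l := famseq F.
Implicit Types (T : {set 'I_r}) (z : koszul M l).

(** The structure map of the colimit at exponent [a]. The lemmas below give its compatibility with
    differentials and transitions, then injectivity and surjectivity in the limit. *)
Definition cech_of a z : cochain M f := fun T => frac_at _ a (kcoef z T).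

Lemma cech_d_cech_of a z T : cech_d (cech_of a z) T = cech_of a (kd a z) T.
Proof.
rewrite /cech_of kcoef_kd raddf_sum /=; apply: eq_bigr => t tT.
rewrite raddfMz /=; congr (_ *~ _); rewrite /frac_at.
by rewrite (loc_mapE (cech_denD1 f tT)).
Qed.

Lemma cech_of0 a T : cech_of a 0 T = 0.
Proof. by rewrite /cech_of -(subr0 0) kcoefB subrr raddf0. Qed.

Lemma cech_of_kt N a z T : cech_of (N + a) (kt N z) T = cech_of a z T.
Proof. by rewrite /cech_of kcoef_kt /frac_at -frac_expand. Qed.

Lemma cech_of_eq0 a z : (forall T, cech_of a z T = 0) -> exists N, kt N z = 0.
Proof.
move=> h; have /choice[N eN] T : exists N, cech_den f T ^+ N *: kcoef z T = 0.
  exact/frac_eq0/h.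
exists (\max_T N T); apply: kcoef_eq0 => T; rewrite kcoef_kt.
rewrite -(subnK (leq_bigmax (F := N) T)) exprD -scalerA.
by rewrite [X in _ *: X]eN scaler0.
Qed.

Lemma cech_of_inj a z w : (forall T, cech_of a z T = cech_of a w T) ->
  exists N, kt N z = kt N w.
Proof.
move=> h; have [|N e] := @cech_of_eq0 a (z - w).
  by move=> T; rewrite /cech_of kcoefB raddfB /= [X in X - _]h subrr.
by exists N; apply/eqP; rewrite -subr_eq0 -linearB /= e.
Qed.

Lemma has_degree_den (P : Gam -> set M) T : degrees_ok P l ->
  has_degree P (cech_den f T) (\sum_(t in T) (F t).2).
Proof.
move=> lok; rewrite /cech_den; elim/big_rec2: _ => [|t d h _ hd] g x gx.
  by rewrite addr0 scale1r.
rewrite -scalerA [_ + d]addrC addrA; apply: (lok (F t)); last exact: hd.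
by apply/mem_famseq; exists t.
Qed.

Lemma cech_of_surj (c : cochain M f) (P : Gam -> set M) e :
  degrees_ok P l ->
  (forall T, exists a m, P (e + (\sum_(t in T) (F t).2) *+ a) m /\ c T = frac_at _ a m) ->
  exists a z, khom P a e z /\ c = cech_of a z.
Proof.
move=> lok /common_exponent[T a N m h|a [m cP]].
  by rewrite addnC mulrnDr addrA; apply: has_degreeX h; apply: has_degree_den.
exists a, (koszul_of F m); split.
  by apply/khom_kcoef => T; rewrite kcoef_of; case: (cP T).
by apply/functional_extensionality_dep => T; rewrite /cech_of kcoef_of; case: (cP T).
Qed.

Context (Mg : Gam -> set M) (grM : graded Mg) (lok : degrees_ok Mg l).

Lemma vanish_of_cech e :
  (forall a z q, khom Mg a e z -> kd a z = 0 -> coboundary q (cech_of a z)) ->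
  vanish Mg l e.
Proof.
move=> cob a z hz dz; have /choice[b bP] q := cob a z q hz dz.
(* A primitive in degree [q] is read on sets of cardinality [q - 1], so the primitives for the
   various [q] glue into one. *)
pose b' : cochain M f := fun T => b #|T|.+1 T.
(* No degree is asked of the primitive: the condition is [setT]. *)
have [||a' [w [_ ew]]] := @cech_of_surj b' (fun=> setT) 0.
- by [].
- by move=> T; have [m [u eu]] := Defs.fracP (b' T); exists u, m.
have [T|N e'] := @cech_of_inj (a' + a) (kt a' z) (kd (a' + a) (kt a w)).
  rewrite cech_of_kt -cech_d_cech_of (bP #|T|) //; apply: eq_bigr => t tT.
  rewrite addnC cech_of_kt -ew /b'.
  by rewrite (cardsD1 t T) tT.
exists (N + a')%N, (kt N (kt a w)).
by rewrite -kt_kt e' kt_kd addnA.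
Qed.

Lemma coboundary_of_vanish e q (c : cochain M f) :
  vanish Mg l e ->
  (forall T, #|T| = q -> exists a m,
     Mg (e + (\sum_(t in T) (F t).2) *+ a) m /\ c T = frac_at _ a m) ->
  cocycle q c -> coboundary q c.
Proof.
(* [vanish] concerns all cohomological degrees together; extended by zero, [c] becomes a cocycle in
   all of them. *)
move=> van hc cc; pose c' : cochain M f := fun T => if #|T| == q then c T else 0.
have [T|a [z [hz ez]]] := @cech_of_surj c' Mg e lok.
  rewrite /c'; case: eqP => [/hc//|_]; exists 0%N, 0; split; last by rewrite raddf0.
  exact: graded0.
have dc' T : cech_d c' T = 0.
  have [/eqP Tq|Tq] := boolP (#|T| == q.+1).
    rewrite -[RHS](cc T Tq); apply: eq_bigr => t tT; rewrite /c'.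
    by move: Tq; rewrite (cardsD1 t T) tT add1n => -[->]; rewrite eqxx.
  rewrite /cech_d big1 // => t tT; rewrite /c'.
  move: Tq; rewrite (cardsD1 t T) tT eqSS => /negPf->.
  by rewrite (loc_map0 (cech_denD1 f tT)) mul0rz.
(* A representative of a Cech cocycle is a Koszul cocycle only after a further transition. *)
have [|N dN] := @cech_of_eq0 a (kd a z); first by move=> T; rewrite -cech_d_cech_of -ez.
have [||N' [b eb]] := van (N + a)%N (kt N z); first exact: khom_kt.
  by rewrite -kt_kd.
exists (cech_of (N' + (N + a)) b) => T Tq.
rewrite cech_d_cech_of -eb !cech_of_kt -ez /c' Tq eqxx //.
Qed.

End CechKoszul.

(** * Multidegrees, and comparison of supports for nested ideals *)

Section MultigradedModule.
Context (S : comNzRingType) (k : nat) (n : 'I_k -> nat).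
Local Notation R := (multi_poly S n).
Local Notation Zk := {ffun 'I_k -> int}.

Lemma multideg0 : multideg (n := n) 0%MM = 0.
Proof. by apply/ffunP => i; rewrite !ffunE big1 // => j _; rewrite mnm0E. Qed.

Lemma multidegD (u v : 'X_{1..#|{: multi_index n}|}) :
  multideg (u + v)%MM = multideg u + multideg v.
Proof.
apply/ffunP => i; rewrite !ffunE -PoszD -big_split /=; congr Posz.
by apply: eq_bigr => j _; rewrite mnmDE.
Qed.

Lemma homogeneous_prod (I : finType) (A : {set I}) (f : I -> R) (d : I -> Zk) :
  (forall t, homogeneous (d t) (f t)) ->
  homogeneous (\sum_(t in A) d t) (\prod_(t in A) f t).
Proof.
move=> hf; elim/big_rec2: _ => [m|t y x _ ih m].
  by rewrite msupp1 inE => /eqP->; apply: multideg0.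
move=> /msuppM_le /allpairsP[[u v] /= [/hf<- /ih<- ->]]; exact: multidegD.
Qed.

Lemma homogeneous_uniq (f : R) (d d' : Zk) :
  f != 0 -> homogeneous d f -> homogeneous d' f -> d = d'.
Proof.
rewrite -msupp_eq0; case e: (msupp f) => [//|m s] _ h h'.
by rewrite -(h m) ?e ?mem_head // -(h' m) ?e ?mem_head.
Qed.

Definition natural_degree (d : Zk) := exists mu : {ffun 'I_k -> nat}, d = [ffun i => (mu i)%:Z].

Lemma natural_degree0 : natural_degree 0.
Proof. by exists [ffun=> 0%N]; apply/ffunP => i; rewrite !ffunE. Qed.

Lemma natural_degreeD d d' : natural_degree d -> natural_degree d' -> natural_degree (d + d').
Proof.
move=> [mu ->] [nu ->]; exists [ffun i => (mu i + nu i)%N].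
by apply/ffunP => i; rewrite !ffunE.
Qed.

(** A nonzero [f] has the multidegree of one of its monomials; the zero polynomial has every degree,
    and [0] is chosen. *)
Lemma homogeneous_natural (f : R) :
  (exists d, homogeneous d f) -> exists d, homogeneous d f /\ natural_degree d.
Proof.
have [->|] := eqVneq f 0.
  move=> _; exists 0; split; last exact: natural_degree0.
  by move=> m; rewrite msupp0.
rewrite -msupp_eq0; case e: (msupp f) => [//|m s] _ [d h]; exists d; split=> //.
exists [ffun i => \sum_(j < n i) m (var_rank j)]%N.
by rewrite -(h m) ?e ?mem_head //; apply/ffunP => i; rewrite !ffunE.
Qed.

Lemma hgens_degrees (I : set R) (F : hgens I) : exists D : 'I_(hgens_size F) -> Zk,
  forall t, homogeneous (D t) (F t) /\ natural_degree (D t).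
Proof.
have /choice[D hD] t : exists d, homogeneous d (F t) /\ natural_degree d.
  exact/homogeneous_natural/hgens_homogeneous.
by exists D.
Qed.

Lemma hgens_mem (I : set R) (F : hgens I) t : I (F t).
Proof.
rewrite -[X in X _](hgens_span F); exists (fun u => (u == t)%:R).
rewrite (bigD1 t) //= eqxx mul1r big1 ?addr0 // => u /negPf->.
by rewrite mul0r.
Qed.

Lemma ideal_sum_sub (p : nat) (g : 'I_p -> set R) j : (forall i, g i 0) -> g j `<=` ideal_sum g.
Proof.
move=> g0 x gx; exists (fun i => if i == j then x else 0); split.
  by move=> i; case: eqP => [->|].
by rewrite -big_mkcond big_pred1_eq.
Qed.

Lemma block_ideal0 i : block_ideal S n i 0.
Proof. by exists (fun=> 0); rewrite big1 // => j _; rewrite mul0r. Qed.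

Context (M : lmodType R) (Mg : Zk -> set M) (hM : is_grading Mg).

Lemma is_grading_graded : graded Mg.
Proof. by case: hM => *; split. Qed.

(** The degree of a nonzero denominator is unique, hence the sum of the [D t]. When the denominator
    is zero, so is the localization, and [x] is the fraction [0]. *)
Lemma loc_homogeneousP r (f : 'I_r -> R) (D : 'I_r -> Zk) e (T : {set 'I_r})
    (x : loc M (cech_den f T)) : (forall t, homogeneous (D t) (f t)) ->
  loc_homogeneous Mg e x <->
  exists a m, Mg (e + (\sum_(t in T) D t) *+ a) m /\ x = frac_at _ a m.
Proof.
move=> hf; have hden := homogeneous_prod (A := T) hf.
split=> [[d [m [a [hd hm ->]]]]|[a [m [hm ->]]]]; last first.
  by exists (\sum_(t in T) D t), m, a.
have [f0|fn0] := eqVneq (cech_den f T) 0; last first.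
  by exists a, m; rewrite (homogeneous_uniq fn0 hden hd).
exists 0%N, 0; split; first exact: graded0 is_grading_graded _.
by apply/eq_fracP; exists 1%N; rewrite !f0 !expr0n /= !scale0r.
Qed.

(** The hypothesis on [d] says that [e] lies outside the starred support of [G]; the two generating
    sets are related only through the inclusion of ideals. *)
Lemma cohomology_support_sub (I J : set R) (F : hgens I) (G : hgens J) e :
  J `<=` I ->
  (forall d, natural_degree d -> ~ cohomology_support Mg G (e + d)) ->
  ~ cohomology_support Mg F e.
Proof.
move=> JI noG [q [c [hc cc]]]; apply.
have [D hD] := hgens_degrees F; have [E hE] := hgens_degrees G.
have grM := is_grading_graded.
pose l := famseq (fun t => (F t, D t)); pose l' := famseq (fun t => (G t, E t)).
have lok : degrees_ok Mg l.
  by move=> _ /mem_famseq[t ->] g x /=; apply: gradingZ => //; case: (hD t).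
have lok' : degrees_ok Mg l'.
  by move=> _ /mem_famseq[t ->] g x /=; apply: gradingZ => //; case: (hE t).
have ok_cat s s' : degrees_ok Mg s -> degrees_ok Mg s' -> degrees_ok Mg (s ++ s').
  by move=> h h' x; rewrite mem_cat => /orP[/h|/h'].
apply: (coboundary_of_vanish (F := fun t => (F t, D t)) grM lok (e := e)) => //; last first.
  by move=> T /hc /(loc_homogeneousP _ _ (fun t => (hD t).1)).
apply: (vanish_drop (l1 := l') grM); first exact: ok_cat.
  move=> _ a /mem_famseq[t ->] /=.
  have [b ->] : ideal_span F (G t) by rewrite hgens_span; apply: JI; apply: hgens_mem.
  apply: rad_kills_sum => u.
  by apply: (mem_rad_kills M a (d := D u)); apply/mem_famseq; exists u.
(* Generators are both adjoined and dropped at the front, so the two blocks are exchanged in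
   between. *)
apply: (vanish_iso (kiso_catC grM l l')); rewrite -[e]addr0.
apply: (vanish_catl grM (P := natural_degree)) => //.
- exact: ok_cat.
- by move=> _ /mem_famseq[t ->] /=; case: (hD t).
- exact: natural_degree0.
- exact: natural_degreeD.
- move=> d nd; apply: vanish_of_cech => a z r hz dz.
  apply: contrapT => ncb; apply: (noG d nd); exists r, (cech_of a z); split=> //.
    move=> T _; apply/(loc_homogeneousP _ _ (fun t => (hE t).1)).
    by exists a, (kcoef z T); split=> //; move/khom_kcoef: hz; apply.
  by move=> T _; have := cech_d_cech_of a z T; rewrite dz cech_of0.
- exact: natural_degree0.
Qed.

End MultigradedModule.

Theorem mainTheorem5 (S : comNzRingType) (k : nat) (n : 'I_k -> nat)
    (hk : (1 <= k)%N) (hn : forall i, (1 <= n i)%N)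
    (M : lmodType (multi_poly S n)) (Mg : {ffun 'I_k -> int} -> set M)
    (hM : is_grading Mg)
    (p : nat) (hp : (1 <= p)%N) (i : 'I_p -> 'I_k) (hi : injective i)
    (F : hgens (ideal_sum (fun j : 'I_p => block_ideal S n (i j))))
    (G : forall j : 'I_p, hgens (block_ideal S n (i j))) :
  star (cohomology_support Mg F) `<=`
    \bigcap_(j in [set: 'I_p]) star (cohomology_support Mg (G j)).
Proof.
move=> _ [e [mu [he ->]]] j _; apply: contrapT => no_star.
apply: (cohomology_support_sub (G := G j) hM _ _ he).
  by apply: (ideal_sum_sub (g := fun j => block_ideal S n (i j))) => u; apply: block_ideal0.
move=> _ [nu ->] hG; apply: no_star.
(* If [e + nu] were in the support for [G j], then [e - mu = (e + nu) - (mu + nu)] would be in its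
   star. *)
exists (e + [ffun t => (nu t)%:Z]), [ffun t => (mu t + nu t)%N]; split=> //.
by apply/ffunP => t; rewrite !ffunE PoszD; ring.
Qed.
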